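(* Let $\Lambda$ be an Artin algebra and let $\Delta_{(\phi,\phi)}=\begin{pmatrix}\Lambda & \Lambda\\ \Lambda & \Lambda\end{pmatrix}$. For a $\Lambda$-module $X$ the following statements are equivalent: (i) $X\in\mathrm{Gproj}\,\Lambda$; (ii) $\mathsf T_1(X)\in\mathrm{Gproj}\,\Delta_{(\phi,\phi)}$; (iii) $\mathsf T_2(X)\in\mathrm{Gproj}\,\Delta_{(\phi,\phi)}$.
   Context: $\phi\colon\Lambda\otimes_\Lambda\Lambda\to\Lambda$ is a $\Lambda$-$\Lambda$-bimodule homomorphism; $\Delta_{(\phi,\phi)}$ is the Morita ring with all entries $\Lambda$ and multiplication $\begin{pmatrix}a & n\\ m & b\end{pmatrix}\begin{pmatrix}a' & n'\\ m' & b'\end{pmatrix}=\begin{pmatrix}aa'+\phi(n\otimes m') & an'+nb'\\ ma'+bm' & bb'+\phi(m\otimes n')\end{pmatrix}$. Modules are finitely generated left modules. Put $c=\phi(1\otimes1)$, a central element of $\Lambda$. $\Delta_{(\phi,\phi)}$-modules are identified with tuples $(X,Y,f,g)$ with $\Lambda$-maps $f\colon X\to Y$ and $g\colon Y\to X$ whose composites $X\to Y\to X$ and $Y\to X\to Y$ are multiplication by $c$; action: $\begin{pmatrix}a & n\\ m & b\end{pmatrix}(x,y)=(ax+n g(y),by+m f(x))$. The functors $\mathsf T_1,\mathsf T_2\colon\mathrm{mod}\,\Lambda\to\mathrm{mod}\,\Delta_{(\phi,\phi)}$ are $\mathsf T_1(X)=(X,X,\mathrm{Id}_X,c\cdot)$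 and $\mathsf T_2(X)=(X,X,c\cdot,\mathrm{Id}_X)$. For an Artin algebra $\Gamma$: an acyclic complex $P^\bullet$ of finitely generated projectives is totally acyclic if $\mathrm{Hom}_\Gamma(P^\bullet,\Gamma)$ is acyclic; a module is Gorenstein-projective if it is $\mathrm{Coker}(P^{-1}\to P^0)$ for some totally acyclic $P^\bullet$; $\mathrm{Gproj}\,\Gamma$ is the category of finitely generated Gorenstein-projective modules. *)

(* Defs.v *)
From HB Require Import structures.
From mathcomp Require Import all_boot all_order all_algebra.

Set Implicit Arguments.
Unset Strict Implicit.
Unset Printing Implicit Defensive.

Import GRing.Theory.
Local Open Scope ring_scope.

(* All rings are pzRingType's, so that the zero ring is not excluded. *)

Definition is_ideal (k : comPzRingType) (I : k -> Prop) : Prop :=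
  [/\ I 0, forall x y, I x -> I y -> I (x + y) & forall a x, I x -> I (a * x)].

Definition artinian (k : comPzRingType) : Prop :=
  forall I : nat -> k -> Prop,
    (forall n, is_ideal (I n)) ->
    (forall n x, I n.+1 x -> I n x) ->
    exists N, forall n, (N <= n)%N -> forall x, I N x -> I n x.

(* [iota] is the structure map of the k-algebra L.  MathComp's [algType k] is
   not used because it forces L to be nonzero. *)
Definition artin_algebra (k : comPzRingType) (L : pzRingType)
    (iota : {rmorphism k -> L}) : Prop :=
  [/\ artinian k,
      forall (a : k) (x : L), iota a * x = x * iota a
    & exists (n : nat) (e : 'I_n -> L),
        forall x : L, exists a : 'I_n -> k, x = \sum_(i < n) iota (a i) * e i].

Section Modules.
Variable R : pzRingType.

Definition finitely_generated (M : lmodType R) : Prop :=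
  exists (n : nat) (e : 'I_n -> M),
    forall x : M, exists a : 'I_n -> R, x = \sum_(i < n) a i *: e i.

Definition projective (P : lmodType R) : Prop :=
  forall (M N : lmodType R) (p : {linear M -> N}) (f : {linear P -> N}),
    (forall y : N, exists x : M, p x = y) ->
    exists g : {linear P -> M}, forall x : P, p (g x) = f x.

Record cochain_seq := CochainSeq {
  cterm :> int -> lmodType R;
  cdiff : forall i : int, {linear cterm i -> cterm (i + 1)}
}.

(* Exactness at degree i + 1, for every i; the right-to-left implication
   contains the equation d \o d = 0. *)
Definition acyclic (P : cochain_seq) : Prop :=
  forall (i : int) (y : P (i + 1)),
    cdiff P (i + 1) y = 0 <-> exists x : P i, cdiff P i x = y.

(* Exactness of Hom(P^{i+2}, R) -> Hom(P^{i+1}, R) -> Hom(P^i, R) at the middle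
   term, for every i, where R^o is R as a left module over itself. *)
Definition hom_acyclic (P : cochain_seq) : Prop :=
  forall (i : int) (h : {linear P (i + 1) -> R^o}),
    (forall x : P i, h (cdiff P i x) = 0) <->
    exists h' : {linear P (i + 1 + 1) -> R^o},
      forall y : P (i + 1), h' (cdiff P (i + 1) y) = h y.

Definition totally_acyclic (P : cochain_seq) : Prop :=
  [/\ forall i, finitely_generated (P i), forall i, projective (P i),
      acyclic P & hom_acyclic P].

(* p exhibits X as (a module isomorphic to) N / f(M). *)
Definition is_coker (M N X : lmodType R) (f : {linear M -> N})
    (p : {linear N -> X}) : Prop :=
  (forall x : X, exists y : N, p y = x) /\
  (forall y : N, p y = 0 <-> exists z : M, f z = y).

Definition gorenstein_projective (X : lmodType R) : Prop :=
  exists P : cochain_seq, totally_acyclic P /\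
    exists p : {linear P 0 -> X},
      @is_coker (P (-1)) (P 0) X (cdiff P (-1)) p.

Definition Gproj (X : lmodType R) : Prop :=
  finitely_generated X /\ gorenstein_projective X.

End Modules.

(* A homomorphism of L-L-bimodules phi : L (x)_L L -> L, given by the map
   (x, y) |-> phi (x (x) y): homomorphisms out of the tensor product are
   biadditive L-balanced maps. *)
Record tensor_bimod_hom (L : pzRingType) := TensorBimodHom {
  tbh_fun :> L -> L -> L;
  tbh_addl : forall x x' y, tbh_fun (x + x') y = tbh_fun x y + tbh_fun x' y;
  tbh_addr : forall x y y', tbh_fun x (y + y') = tbh_fun x y + tbh_fun x y';
  tbh_balanced : forall x a y, tbh_fun (x * a) y = tbh_fun x (a * y);
  tbh_linl : forall a x y, tbh_fun (a * x) y = a * tbh_fun x y;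
  tbh_linr : forall x y b, tbh_fun x (y * b) = tbh_fun x y * b
}.

Section TensorBimodHom.
Variables (L : pzRingType) (phi : tensor_bimod_hom L).

Definition tbh_c : L := phi 1 1.

Lemma tbh_cC a : tbh_c * a = a * tbh_c.
Proof.
by rewrite /tbh_c -tbh_linr -tbh_linl mul1r mulr1 -[in LHS](mulr1 a) -tbh_balanced mul1r.
Qed.

Lemma tbhE x y : phi x y = tbh_c * (x * y).
Proof.
by rewrite -{1}[x]mulr1 tbh_linl -{1}[y]mul1r tbh_linr -/tbh_c !mulrA tbh_cC.
Qed.

End TensorBimodHom.

(* The element (a n; m b) of the Morita ring. *)
Record morita (L : pzRingType) (phi : tensor_bimod_hom L) := Morita {
  m11 : L; m12 : L;
  m21 : L; m22 : L
}.

Section MoritaRing.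
Variables (L : pzRingType) (phi : tensor_bimod_hom L).
Local Notation D := (morita phi).

Definition morita_tuple (u : D) := (m11 u, m12 u, (m21 u, m22 u)).
Definition tuple_morita (t : (L * L) * (L * L)) : D :=
  Morita phi t.1.1 t.1.2 t.2.1 t.2.2.

Lemma morita_tupleK : cancel morita_tuple tuple_morita.
Proof. by case. Qed.

HB.instance Definition _ := Choice.copy D (can_type morita_tupleK).

Definition morita_zero : D := Morita phi 0 0 0 0.
Definition morita_opp (u : D) : D :=
  Morita phi (- m11 u) (- m12 u) (- m21 u) (- m22 u).
Definition morita_add (u v : D) : D :=
  Morita phi (m11 u + m11 v) (m12 u + m12 v) (m21 u + m21 v) (m22 u + m22 v).

Lemma morita_addA : associative morita_add.
Proof. by move=> u v w; congr Morita; rewrite /= addrA. Qed.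
Lemma morita_addC : commutative morita_add.
Proof. by move=> u v; congr Morita; rewrite addrC. Qed.
Lemma morita_add0 : left_id morita_zero morita_add.
Proof. by case=> a n m b; congr Morita; rewrite /= add0r. Qed.
Lemma morita_addN : left_inverse morita_zero morita_opp morita_add.
Proof. by move=> u; congr Morita; rewrite /= addNr. Qed.

HB.instance Definition _ := GRing.isZmodule.Build D
  morita_addA morita_addC morita_add0 morita_addN.

Definition morita_one : D := Morita phi 1 0 0 1.
Definition morita_mul (u v : D) : D :=
  Morita phi
    (m11 u * m11 v + phi (m12 u) (m21 v)) (m11 u * m12 v + m12 u * m22 v)
    (m21 u * m11 v + m22 u * m21 v)       (m22 u * m22 v + phi (m21 u) (m12 v)).

Lemma morita_mulA : associative morita_mul.
Proof.
have cA (x y : L) : x * (tbh_c phi * y) = tbh_c phi * (x * y).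
  by rewrite !mulrA tbh_cC.
move=> u v w; congr Morita; rewrite /= ?tbhE !(mulrDl, mulrDr) -?mulrA ?cA.
- by rewrite addrACA.
- by rewrite [X in _ + X = _]addrC addrACA.
- by rewrite [X in _ = _ + X]addrC [RHS]addrACA.
- by rewrite [X in _ + X = _]addrC addrACA; congr (_ + _); rewrite addrC.
Qed.

Lemma morita_mul1l : left_id morita_one morita_mul.
Proof.
by case=> a n m b; congr Morita; rewrite /= ?tbhE !(mul1r, mul0r, mulr0) ?(addr0, add0r).
Qed.

Lemma morita_mul1r : right_id morita_one morita_mul.
Proof.
by case=> a n m b; congr Morita; rewrite /= ?tbhE !(mulr1, mulr0) ?(addr0, add0r).
Qed.

Lemma morita_mulDl : left_distributive morita_mul +%R.
Proof.
by move=> u v w; congr Morita; rewrite /= ?tbhE !mulrDl ?mulrDr addrACA.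
Qed.

Lemma morita_mulDr : right_distributive morita_mul +%R.
Proof.
by move=> u v w; congr Morita; rewrite /= ?tbhE !mulrDr addrACA.
Qed.

HB.instance Definition _ := GRing.Zmodule_isPzRing.Build D
  morita_mulA morita_mul1l morita_mul1r morita_mulDl morita_mulDr.

End MoritaRing.

(* The tuple (X, Y, f, g) attached to a module over the Morita ring. *)
Record morita_rep (L : pzRingType) (phi : tensor_bimod_hom L)
    (X Y : lmodType L) := MoritaRep {
  rep_f : {linear X -> Y};
  rep_g : {linear Y -> X};
  rep_gf : forall x : X, rep_g (rep_f x) = tbh_c phi *: x;
  rep_fg : forall y : Y, rep_f (rep_g y) = tbh_c phi *: y
}.

(* The module over the Morita ring attached to (X, Y, f, g): the group X * Y
   with the action (a n; m b)(x, y) = (a x + n g(y), b y + m f(x)). *)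
Definition rep_mod (L : pzRingType) (phi : tensor_bimod_hom L)
  (X Y : lmodType L) (r : morita_rep phi X Y) : Type := (X * Y)%type.

Section RepModule.
Variables (L : pzRingType) (phi : tensor_bimod_hom L).
Variables (X Y : lmodType L) (r : morita_rep phi X Y).
Local Notation D := (morita phi).
Local Notation M := (rep_mod r).

HB.instance Definition _ := GRing.Zmodule.copy M (X * Y)%type.

Definition rep_scale (u : D) (v : M) : M :=
  (m11 u *: v.1 + m12 u *: rep_g r v.2, m22 u *: v.2 + m21 u *: rep_f r v.1).

Lemma rep_scaleA u v w : rep_scale u (rep_scale v w) = rep_scale (u * v) w.
Proof.
have cS (Z : lmodType L) (x y : L) (z : Z) :
    x *: (y *: (tbh_c phi *: z)) = phi x y *: z.
  by rewrite tbhE tbh_cC !scalerA.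
congr pair; rewrite /= linearD !linearZ /= ?rep_gf ?rep_fg !scalerDr cS
  !scalerA !scalerDl.
- by rewrite [X in _ + X = _]addrC addrACA.
- by rewrite [X in _ + X = _]addrC addrACA; congr (_ + _); rewrite addrC.
Qed.

Lemma rep_scale1 : left_id 1 rep_scale.
Proof. by case=> x y; congr pair; rewrite /= scale1r scale0r addr0. Qed.

Lemma rep_scaleDr : right_distributive rep_scale +%R.
Proof. by move=> u v w; congr pair; rewrite /= !linearD !scalerDr addrACA. Qed.

Lemma rep_scaleDl v : {morph rep_scale^~ v : a b / a + b}.
Proof. by move=> a b; congr pair; rewrite /= !scalerDl addrACA. Qed.

HB.instance Definition _ := GRing.Zmodule_isLmodule.Build D M
  rep_scaleA rep_scale1 rep_scaleDr rep_scaleDl.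

End RepModule.

Section FunctorsT.
Variables (L : pzRingType) (phi : tensor_bimod_hom L) (X : lmodType L).

Definition cmul (x : X) : X := tbh_c phi *: x.

Lemma cmul_is_linear : linear cmul.
Proof. by move=> a x y; rewrite /cmul scalerDr !scalerA tbh_cC. Qed.

HB.instance Definition _ := GRing.isLinear.Build L X X *:%R cmul cmul_is_linear.

Definition T1_rep : morita_rep phi X X :=
  @MoritaRep L phi X X (@idfun X) cmul (fun=> erefl) (fun=> erefl).

Definition T2_rep : morita_rep phi X X :=
  @MoritaRep L phi X X cmul (@idfun X) (fun=> erefl) (fun=> erefl).

Definition T1 : lmodType (morita phi) := rep_mod T1_rep.
Definition T2 : lmodType (morita phi) := rep_mod T2_rep.

End FunctorsT.

(* Main.v *)
Require Import Defs.
From HB Require Import structures.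
From mathcomp Require Import all_boot all_order all_algebra.

(** Let [e11], [e22] be the diagonal idempotents of the Morita ring D and
    [U_i M = e_ii M].  The functor [T1] is left adjoint to [U_1] and right
    adjoint to [U_2]; symmetrically, [T2] is left adjoint to [U_2] and right
    adjoint to [U_1].  All these functors are exact, hence [T_i] and [U_i]
    preserve finitely generated projectives.  As [U_i D] is free of rank 2,
    [Hom (T_i P, D) = Hom (P, U_i D)] is acyclic whenever [Hom (P, L)] is; as
    [T2 L] is a direct summand of D, [Hom (U_1 Q, L) = Hom (Q, T2 L)] is acyclic
    whenever [Hom (Q, D)] is.  So [T_i] and [U_1] preserve totally acyclic
    complexes, and [U_1 (T_i X) = X]. *)

Set Implicit Arguments.
Unset Strict Implicit.
Unset Printing Implicit Defensive.

Import GRing.Theory.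
Local Open Scope ring_scope.

Definition mk_linear (R : pzRingType) (U V : lmodType R) (f : U -> V)
    (f_lin : linear f) : {linear U -> V} :=
  HB.pack f (GRing.isLinear.Build R U V *:%R f f_lin).

Lemma acyclic_diff2 (R : pzRingType) (P : cochain_seq R) :
  acyclic P -> forall i (x : P i), cdiff P (i + 1) (cdiff P i x) = 0.
Proof. by move=> acP i x; apply/acP; exists x. Qed.

Section Corner.
Variables (L : pzRingType) (phi : tensor_bimod_hom L).
Local Notation D := (morita phi).
Implicit Type b : bool.

(** * Matrix units of the Morita ring *)

Lemma morita_eqP (u v : D) :
  m11 u = m11 v -> m12 u = m12 v -> m21 u = m21 v -> m22 u = m22 v -> u = v.
Proof. by case: u v => ? ? ? ? [? ? ? ?] /= -> -> -> ->. Qed.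

(* The boolean selects the corner: [true] is (1,1), and [false] is (2,2). *)
Definition diagE b (a : L) : D := if b then Morita phi a 0 0 0 else Morita phi 0 0 0 a.
Definition offE b (a : L) : D := if b then Morita phi 0 a 0 0 else Morita phi 0 0 a 0.

Ltac by_entries :=
  apply: morita_eqP; rewrite /= ?tbhE ?(mulr0, mul0r, addr0, add0r, mulr1, mul1r).

Lemma diagED b a a' : diagE b (a + a') = diagE b a + diagE b a'.
Proof. by case: b; by_entries. Qed.

Lemma diagEM b a a' : diagE b (a * a') = diagE b a * diagE b a'.
Proof. by case: b; by_entries. Qed.

Lemma diagEMoff b a a' : diagE b a * offE b a' = offE b (a * a').
Proof. by case: b; by_entries. Qed.

(** * Corner modules [e_bb M] over [L], and their functoriality *)

Section CornerModule.
Variables (b : bool) (M : lmodType D).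

Definition in_corner : {pred M} := [pred x | diagE b 1 *: x == x].

Lemma in_cornerP x : reflect (diagE b 1 *: x = x) (x \in in_corner).
Proof. exact: eqP. Qed.

Lemma in_corner_zmod_closed : zmod_closed in_corner.
Proof.
split=> [|x y /in_cornerP ex /in_cornerP ey]; apply/in_cornerP.
  by rewrite scaler0.
by rewrite scalerBr ex ey.
Qed.

HB.instance Definition _ := GRing.isZmodClosed.Build M in_corner in_corner_zmod_closed.

Record corner := Corner { corner_val : M; corner_valP : corner_val \in in_corner }.

HB.instance Definition _ := [isSub for corner_val].
HB.instance Definition _ := [Choice of corner by <:].
HB.instance Definition _ := [SubChoice_isSubZmodule of corner by <:].

Lemma cornerE (x : corner) : diagE b 1 *: corner_val x = corner_val x.
Proof. exact/in_cornerP/corner_valP. Qed.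

Lemma in_corner_diag a x : diagE b a *: x \in in_corner.
Proof. by apply/in_cornerP; rewrite scalerA -diagEM mul1r. Qed.

Lemma in_corner_off a x : offE b a *: x \in in_corner.
Proof. by apply/in_cornerP; rewrite scalerA diagEMoff mul1r. Qed.

(** [L] acts through the non-unital embedding [diagE b]; the action is unital because [diagE b 1]
    fixes the corner. *)
Definition corner_scale (a : L) (x : corner) : corner :=
  Corner (in_corner_diag a (corner_val x)).

Lemma corner_scaleA a a' x :
  corner_scale a (corner_scale a' x) = corner_scale (a * a') x.
Proof. by apply: val_inj; rewrite /= scalerA diagEM. Qed.

Lemma corner_scale1 : left_id 1 corner_scale.
Proof. by move=> x; apply: val_inj; rewrite /= cornerE. Qed.

Lemma corner_scaleDr : right_distributive corner_scale +%R.
Proof. by move=> a x y; apply: val_inj; rewrite /= scalerDr. Qed.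

Lemma corner_scaleDl x : {morph corner_scale^~ x : a a' / a + a'}.
Proof. by move=> a a'; apply: val_inj; rewrite /= diagED scalerDl. Qed.

HB.instance Definition _ := GRing.Zmodule_isLmodule.Build L corner
  corner_scaleA corner_scale1 corner_scaleDr corner_scaleDl.

Definition cdiag (x : M) : corner := Corner (in_corner_diag 1 x).
(** For [b = true] this is the structure map [g] of the tuple of [M] applied to the [e22] component
    of [x], since the matrix unit at (1,2) kills [e11 M]; [b = false] gives [f]. *)
Definition coff (x : M) : corner := Corner (in_corner_off 1 x).

Lemma cdiagK (x : corner) : cdiag (corner_val x) = x.
Proof. by apply: val_inj; rewrite /= cornerE. Qed.

Lemma cdiag0 : cdiag 0 = 0.
Proof. by apply: val_inj; rewrite /= scaler0. Qed.

Lemma cdiagD x y : cdiag (x + y) = cdiag x + cdiag y.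
Proof. by apply: val_inj; rewrite /= scalerDr. Qed.

Lemma coffD x y : coff (x + y) = coff x + coff y.
Proof. by apply: val_inj; rewrite /= scalerDr. Qed.

End CornerModule.

Section CornerMap.
Variables (b : bool) (M N : lmodType D) (f : {linear M -> N}).

Lemma in_corner_map (x : corner b M) : f (corner_val x) \in @in_corner b N.
Proof. by apply/in_cornerP; rewrite -linearZ cornerE. Qed.

Definition corner_map_fun (x : corner b M) : corner b N := Corner (in_corner_map x).

Lemma corner_map_linear : linear corner_map_fun.
Proof. by move=> a x y; apply: val_inj; rewrite /= linearP. Qed.

Definition corner_map : {linear corner b M -> corner b N} := mk_linear corner_map_linear.

Lemma corner_map_val x : corner_val (corner_map x) = f (corner_val x).
Proof. by []. Qed.

Lemma corner_map_cdiag x : corner_map (cdiag b x) = cdiag b (f x).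
Proof. by apply: val_inj; rewrite /= linearZ. Qed.

Lemma corner_map_coff x : corner_map (coff b x) = coff b (f x).
Proof. by apply: val_inj; rewrite /= linearZ. Qed.

Lemma corner_map_surj :
  (forall y, exists x, f x = y) -> forall y, exists x, corner_map x = y.
Proof.
move=> f_surj y; have [x fx] := f_surj (corner_val y).
by exists (cdiag b x); rewrite corner_map_cdiag fx cdiagK.
Qed.

End CornerMap.

(** * The first corner preserves totally acyclic complexes *)

Lemma cdiagZ (M : lmodType D) (u : D) (x : M) :
  cdiag true (u *: x) = m11 u *: cdiag true x + m12 u *: coff true x.
Proof.
apply: val_inj; rewrite /= !scalerA -scalerDl.
by congr (_ *: _); by_entries.
Qed.

(** The product [offE true 1 * u] has first row [(c * m21 u, m22 u)], with [c] central. With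
    [cdiagZ], the pair of [cdiag] and [coff] transforms as an element of [T2], which makes
    [coinduce] linear. *)
Lemma coffZ (M : lmodType D) (u : D) (x : M) :
  coff true (u *: x) = m22 u *: coff true x + (m21 u * tbh_c phi) *: cdiag true x.
Proof.
apply: val_inj; rewrite /= !scalerA -scalerDl.
by congr (_ *: _); by_entries; rewrite // tbh_cC.
Qed.

(** By [cdiagZ], each generator [e i] of [M] contributes the two generators [cdiag true (e i)] and
    [coff true (e i)]. *)
Lemma corner_fg (M : lmodType D) :
  finitely_generated M -> finitely_generated (corner true M).
Proof.
case=> n [e eP]; exists (n + n)%N.
exists (fun i => match split i with
  inl i => cdiag true (e i) | inr i => coff true (e i) end) => x.
have [a xE] := eP (corner_val x).
exists (fun i => match split i with inl i => m11 (a i) | inr i => m12 (a i) end).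
rewrite -{1}[x]cdiagK {1}xE (big_morph _ (@cdiagD true M) (@cdiag0 true M)).
rewrite big_split_ord /= -big_split; apply: eq_bigr => i _.
by rewrite cdiagZ (unsplitK (inl i)) (unsplitK (inr i)).
Qed.

(* The isomorphism [Hom_L (U_1 M, N) = Hom_D (M, T2 N)]. *)
Section CoInduce.
Variables (M : lmodType D) (N : lmodType L) (f : {linear corner true M -> N}).

Definition coinduce_fun (x : M) : T2 phi N := (f (cdiag true x), f (coff true x)).

Lemma coinduce_linear : linear coinduce_fun.
Proof.
move=> u x y; congr pair => /=.
  by rewrite cdiagD cdiagZ !linearD !linearZ.
by rewrite coffD coffZ !linearD !linearZ /= scalerA.
Qed.

Definition coinduce : {linear M -> T2 phi N} := mk_linear coinduce_linear.

End CoInduce.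

Section FstCorner.
Variables (M : lmodType D) (X Y : lmodType L) (r : morita_rep phi X Y).
Variable g : {linear M -> rep_mod r}.

Definition fst_corner_fun (x : corner true M) : X := (g (corner_val x)).1.

Lemma fst_corner_linear : linear fst_corner_fun.
Proof.
by move=> a x y; rewrite /fst_corner_fun /= linearP /= scale0r addr0.
Qed.

Definition fst_corner : {linear corner true M -> X} := mk_linear fst_corner_linear.

Lemma snd_corner (x : corner true M) : (g (corner_val x)).2 = 0.
Proof. by rewrite -cornerE linearZ /= !scale0r addr0. Qed.

End FstCorner.

(** The lifting problem is transposed along the adjunction: [T2] keeps [p] surjective, [coinduce f]
    lifts through it, and the first component of the lift on the corner solves the original
    problem. *)
Lemma corner_projective (M : lmodType D) : projective M -> projective (corner true M).
Proof.
move=> projM A B p f p_surj.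
pose Tp_fun (v : T2 phi A) : T2 phi B := (p v.1, p v.2).
have Tp_lin : linear Tp_fun.
  by move=> u v w; congr pair; rewrite /= !linearD !linearZ //= /cmul linearZ.
case: (projM _ _ (mk_linear Tp_lin) (coinduce f)) => [[y1 y2]|g gP].
  by have [x1 <-] := p_surj y1; have [x2 <-] := p_surj y2; exists (x1, x2).
exists (fst_corner g) => x.
by have /(congr1 fst) := gP (corner_val x); rewrite /= cdiagK.
Qed.

(* [T2 L] embeds in D as the second column. *)
Definition col2 (v : T2 phi L^o) : D := Morita phi 0 v.1 0 v.2.

Lemma col2_linear : linear (col2 : T2 phi L^o -> D^o).
Proof.
move=> u v w; apply: morita_eqP; rewrite /= ?tbhE ?(mulr0, addr0) //.
have cA (x y : L) : x * (tbh_c phi * y) = tbh_c phi * (x * y).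
  by rewrite !mulrA tbh_cC.
by congr (_ + _ + _); apply: cA.
Qed.

(** Transposes back: [col2] stores the first component at entry (1,2), so this map recovers [f] from
    [col2 \o coinduce f]. *)
Lemma m12_corner_linear (M : lmodType D) (h : {linear M -> D^o}) :
  linear (fun x : corner true M => m12 (h (corner_val x)) : L^o).
Proof. by move=> a x y; rewrite /= linearP /= mul0r addr0. Qed.

Definition corner_seq b (Q : cochain_seq D) : cochain_seq L :=
  @CochainSeq L (fun i => corner b (Q i)) (fun i => corner_map b (cdiff Q i)).

(** A preimage in [Q] of a corner element is moved into the corner by [e_bb], which commutes with
    the differential. *)
Lemma corner_acyclic b (Q : cochain_seq D) : acyclic Q -> acyclic (corner_seq b Q).
Proof.
move=> acQ i y; split=> [dy0 | [x <-]]; last first.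
  by apply: val_inj; apply: acyclic_diff2.
have /acQ [x dx] : cdiff Q (i + 1) (corner_val y) = 0 by rewrite -corner_map_val dy0.
by exists (cdiag b x); rewrite -[RHS]cdiagK -dx; apply: corner_map_cdiag.
Qed.

Lemma corner_hom_acyclic (Q : cochain_seq D) :
  acyclic Q -> hom_acyclic Q -> hom_acyclic (corner_seq true Q).
Proof.
move=> acQ hacQ i h; split=> [hd0 | [h' h'E] x]; last first.
  by rewrite -h'E (acyclic_diff2 (corner_acyclic (b := true) acQ)) linear0.
pose g : {linear Q (i + 1) -> D^o} := mk_linear col2_linear \o coinduce h.
have /hacQ [H HE] : forall x, g (cdiff Q i x) = 0.
  (* The first column of [g] is zero; in the second, [cdiag] and [coff] commute with the
     differential, so [hd0] kills both entries. *)
  move=> x; apply: morita_eqP => //=.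
    by rewrite -corner_map_cdiag; apply: hd0.
  by rewrite -corner_map_coff; apply: hd0.
exists (mk_linear (m12_corner_linear H)) => y.
by rewrite /= HE /= cdiagK.
Qed.

Lemma gorenstein_projective_fst (X Y : lmodType L) (r : morita_rep phi X Y) :
  gorenstein_projective (rep_mod r) -> gorenstein_projective X.
Proof.
case=> Q [[fgQ projQ acQ hacQ] [p [p_surj p_ker]]].
exists (corner_seq true Q); split.
  split=> [i|i||]; first exact: corner_fg.
  - exact: corner_projective.
  - exact: corner_acyclic.
  - exact: corner_hom_acyclic.
exists (fst_corner p); split=> [x | y].
  (* Projecting the preimage to the corner does not change its image, as [e11] fixes [(x, 0)]. *)
  have [y py] := p_surj (x, 0); exists (cdiag true y).
  by rewrite /= /fst_corner_fun /= linearZ py /= scale1r scale0r addr0.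
split=> [py0 | [z <-]].
  have /p_ker [z dz] : p (corner_val y) = 0.
    by rewrite [LHS]surjective_pairing snd_corner; congr pair.
  by exists (cdiag true z); rewrite -[RHS]cdiagK -dz; apply: corner_map_cdiag.
have -> // : fst_corner p (cdiff (corner_seq true Q) (-1) z) = (0 : rep_mod r).1.
by congr fst; apply/p_ker; exists (corner_val z).
Qed.

(** * [T1] and [T2] treated together, as left adjoints of the corners [true] and [false] *)

Definition T_rep b (X : lmodType L) : morita_rep phi X X :=
  if b then T1_rep phi X else T2_rep phi X.

Local Notation T b X := (rep_mod (T_rep b X)).

(* The components of a pair inside and outside of the corner b. *)
Definition inner b (X : lmodType L) (v : T b X) : X := if b then v.1 else v.2.
Definition outer b (X : lmodType L) (v : T b X) : X := if b then v.2 else v.1.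
(** The unit of the adjunction, with values in corner [b] of [T b X]. *)
Definition T_unit b (X : lmodType L) (x : X) : T b X := if b then (x, 0) else (0, x).

Lemma T_unit0 b (X : lmodType L) : T_unit b (0 : X) = 0.
Proof. by case: b. Qed.

Lemma T_unitD b (X : lmodType L) (x y : X) :
  T_unit b (x + y) = T_unit b x + T_unit b y.
Proof. by case: b; congr pair; rewrite /= addr0. Qed.

Lemma T_unitZ b (X : lmodType L) a (x : X) :
  T_unit b (a *: x) = diagE b a *: T_unit b x.
Proof. by case: b; congr pair; rewrite /= ?scaler0 ?scale0r ?addr0. Qed.

(** The structure map leaving corner [b] is the identity of [X], so the image of the unit generates
    [T b X] over [D]. *)
Lemma T_unit_inner_outer b (X : lmodType L) (v : T b X) :
  v = T_unit b (inner v) + offE (~~ b) 1 *: T_unit b (outer v).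
Proof.
case: b v => -[x y]; congr pair;
  by rewrite /= ?linear0 ?scale0r ?scaler0 ?scale1r ?addr0 ?add0r.
Qed.

Section TMap.
Variables (b : bool) (X Y : lmodType L) (f : {linear X -> Y}).

Definition T_map_fun (v : T b X) : T b Y := (f v.1, f v.2).

Lemma T_map_linear : linear T_map_fun.
Proof.
rewrite /T_map_fun; case: (b) => u v w; congr pair;
  by rewrite /= !linearD !linearZ //= /cmul linearZ.
Qed.

Definition T_map : {linear T b X -> T b Y} := mk_linear T_map_linear.

Lemma inner_map v : inner (T_map v) = f (inner v).
Proof. by rewrite /inner /= /T_map_fun; case: (b). Qed.

Lemma outer_map v : outer (T_map v) = f (outer v).
Proof. by rewrite /outer /= /T_map_fun; case: (b). Qed.

Lemma T_map_unit x : T_map (T_unit b x) = T_unit b (f x).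
Proof. by rewrite /T_unit /= /T_map_fun; case: (b); congr pair; rewrite /= ?linear0. Qed.

End TMap.

(* The two directions of [Hom_D (T X, M) = Hom_L (X, U M)]. *)
Definition induce_fun b (X : lmodType L) (M : lmodType D)
    (g : {linear X -> corner b M}) (v : T b X) : M :=
  corner_val (g (inner v)) + offE (~~ b) 1 *: corner_val (g (outer v)).

Lemma induce_linear b (X : lmodType L) (M : lmodType D)
  (g : {linear X -> corner b M}) : linear (induce_fun g).
Proof.
(* Corner elements are fixed by [e_bb], so a scalar acts on them only through its column [b];
   linearity becomes a comparison of columns. *)
have gE x (u : D) : u *: corner_val (g x) = (u * diagE b 1) *: corner_val (g x).
  by rewrite -scalerA cornerE.
move=> u v w; rewrite /induce_fun scalerDr.
have -> : inner (u *: v + w) = inner (u *: v) + inner w by case: (b) v w.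
have -> : outer (u *: v + w) = outer (u *: v) + outer w by case: (b) v w.
rewrite !linearD /= scalerDr [LHS]addrACA; congr (_ + _).
have eqZ x y (c1 c2 c3 c4 : D) :
    c1 * diagE b 1 = c3 * diagE b 1 -> c2 * diagE b 1 = c4 * diagE b 1 ->
  c1 *: corner_val (g x) + c2 *: corner_val (g y) =
  c3 *: corner_val (g x) + c4 *: corner_val (g y).
  by move=> E1 E2; rewrite gE E1 -gE [c2 *: _]gE E2 -gE.
case: b g gE eqZ v {w} => g gE eqZ [x y];
  rewrite /inner /outer /= !linearD !linearZ /= !scalerDr !scalerA;
  rewrite [X in _ + X = _]addrC [LHS]addrACA -!scalerDl;
  by apply: eqZ; by_entries; rewrite // tbh_cC.
Qed.

Section Induce.
Variables (b : bool) (X : lmodType L) (M : lmodType D).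

Definition induce (g : {linear X -> corner b M}) : {linear T b X -> M} :=
  mk_linear (induce_linear g).

Lemma induceE g v :
  induce g v = corner_val (g (inner v)) + offE (~~ b) 1 *: corner_val (g (outer v)).
Proof. by []. Qed.

Section Restrict.
Variable h : {linear T b X -> M}.

Lemma in_corner_restrict x : h (T_unit b x) \in @in_corner b M.
Proof.
apply/in_cornerP; rewrite -linearZ.
by rewrite -T_unitZ scale1r.
Qed.

Definition restrict_fun x : corner b M := Corner (in_corner_restrict x).

Lemma restrict_linear : linear restrict_fun.
Proof. by move=> a x y; apply: val_inj; rewrite /= T_unitD T_unitZ linearP. Qed.

Definition restrict : {linear X -> corner b M} := mk_linear restrict_linear.

(** A map out of [T b X] is determined by its values on the image of [T_unit]. *)
Lemma restrictK v : induce restrict v = h v.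
Proof. by rewrite [in RHS](T_unit_inner_outer v) linearD linearZ. Qed.

End Restrict.
End Induce.

(** * The functors [T b] preserve totally acyclic complexes *)

Lemma T_fg b (X : lmodType L) : finitely_generated X -> finitely_generated (T b X).
Proof.
case=> n [e eP]; exists n, (fun i => T_unit b (e i)) => v.
have [[a aE] [c cE]] := (eP (inner v), eP (outer v)).
(* The second summand forms [c i *: e i] in corner [b] and then carries it to the outer
   component. *)
exists (fun i => diagE b (a i) + offE (~~ b) 1 * diagE b (c i)).
rewrite [v in LHS]T_unit_inner_outer aE cE.
rewrite !(big_morph _ (@T_unitD b X) (@T_unit0 b X)) scaler_sumr -big_split.
by apply: eq_bigr => i _; rewrite !T_unitZ scalerDl scalerA.
Qed.

(** [restrict f] is lifted through the corner of [p], still surjective, and the lift is induced back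
    up. *)
Lemma T_projective b (P : lmodType L) : projective P -> projective (T b P).
Proof.
move=> projP M N p f p_surj.
have [g gP] := projP _ _ (corner_map b p) (restrict f) (corner_map_surj p_surj).
have pg x : p (corner_val (g x)) = corner_val (restrict f x) by rewrite -gP.
by exists (induce g) => v; rewrite -(restrictK f) !induceE linearD linearZZ !pg.
Qed.

Definition T_seq b (P : cochain_seq L) : cochain_seq D :=
  @CochainSeq D (fun i => T b (P i)) (fun i => T_map b (cdiff P i)).

Lemma T_acyclic b (P : cochain_seq L) : acyclic P -> acyclic (T_seq b P).
Proof.
move=> acP i [y1 y2]; split=> [[/acP [x1 <-] /acP [x2 <-]] | [[x1 x2] <-]].
  by exists (x1, x2).
by congr pair; apply: acyclic_diff2.
Qed.

(* [U_b D] is the row b of D. *)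
Definition row b (s t : L) : D := if b then Morita phi s t 0 0 else Morita phi 0 0 s t.
Definition entry1 b (u : D) : L := if b then m11 u else m21 u.
Definition entry2 b (u : D) : L := if b then m12 u else m22 u.

Lemma in_corner_row b s t : (row b s t : D^o) \in @in_corner b D^o.
Proof. by apply/in_cornerP; case: b; by_entries. Qed.

Lemma row_entry b (u : corner b D^o) :
  row b (entry1 b (corner_val u)) (entry2 b (corner_val u)) = corner_val u.
Proof. by rewrite -cornerE; case: b u => u; by_entries. Qed.

Lemma entry1_linear b : linear (fun u : corner b D^o => entry1 b (corner_val u) : L^o).
Proof. by case: b => a u v; rewrite /= ?tbhE ?(mulr0, mul0r, addr0, add0r). Qed.

Lemma entry2_linear b : linear (fun u : corner b D^o => entry2 b (corner_val u) : L^o).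
Proof. by case: b => a u v; rewrite /= ?tbhE ?(mulr0, mul0r, addr0, add0r). Qed.

Lemma row_linear b (P : lmodType L) (s t : {linear P -> L^o}) :
  linear (fun x => Corner (in_corner_row b (s x) (t x)) : corner b D^o).
Proof.
by move=> a x y; apply: val_inj; rewrite /= !linearP; case: b; by_entries.
Qed.

(** By adjunction [h] is an [L]-map into row [b] of [D], that is, a pair of functionals on [P]. Each
    factors through the differential by hypothesis; [row] reassembles the two factors and [induce]
    returns to [T b]. *)
Lemma T_hom_acyclic b (P : cochain_seq L) :
  acyclic P -> hom_acyclic P -> hom_acyclic (T_seq b P).
Proof.
move=> acP hacP i h; split=> [hd0 | [h' h'E] x]; last first.
  by rewrite -h'E (acyclic_diff2 (T_acyclic (b := b) acP)) linear0.
have kd0 x : restrict h (cdiff P i x) = 0.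
  by apply: val_inj; rewrite /= -T_map_unit; apply: hd0.
pose e1 := mk_linear (@entry1_linear b); pose e2 := mk_linear (@entry2_linear b).
have ekd0 (e : {linear corner b D^o -> L^o}) x : e (restrict h (cdiff P i x)) = 0.
  by rewrite kd0 linear0.
have [[s' s'E] [t' t'E]] :=
  ((hacP i (e1 \o restrict h)).1 (ekd0 e1), (hacP i (e2 \o restrict h)).1 (ekd0 e2)).
pose g := mk_linear (row_linear b s' t').
have gd y : g (cdiff P (i + 1) y) = restrict h y.
  by apply: val_inj; rewrite /= s'E t'E; apply: (row_entry (restrict h y)).
by exists (induce g) => y; rewrite -(restrictK h) !induceE inner_map outer_map !gd.
Qed.

Lemma T_gorenstein_projective b (X : lmodType L) :
  gorenstein_projective X -> gorenstein_projective (T b X).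
Proof.
case=> P [[fgP projP acP hacP] [p [p_surj p_ker]]].
exists (T_seq b P); split.
  split=> [i|i||]; first exact: T_fg.
  - exact: T_projective.
  - exact: T_acyclic.
  - exact: T_hom_acyclic.
exists (T_map b p); split=> [[x1 x2] | [y1 y2]].
  by have [[y1 <-] [y2 <-]] := (p_surj x1, p_surj x2); exists (y1, y2).
split=> [[/p_ker [z1 <-] /p_ker [z2 <-]] | [[z1 z2] [<- <-]]].
  by exists (z1, z2).
by congr pair; apply/p_ker; [exists z1 | exists z2].
Qed.

(** The converse reads off the first corner for either [b], since both entries of the tuple are
    [X]. *)
Lemma Gproj_T b (X : lmodType L) :
  finitely_generated X -> Gproj X <-> Gproj (T b X).
Proof.
move=> fgX; split=> [[_ gpX] | [_ /gorenstein_projective_fst gpX]]; split=> //.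
  exact: T_fg.
exact: T_gorenstein_projective.
Qed.

End Corner.

Theorem corollary3p6 (k : comPzRingType) (L : pzRingType)
  (iota : {rmorphism k -> L}) (hL : artin_algebra iota)
  (phi : tensor_bimod_hom L) (X : lmodType L) (hX : finitely_generated X) :
  (Gproj X <-> Gproj (T1 phi X)) /\ (Gproj (T1 phi X) <-> Gproj (T2 phi X)).
Proof.
(* [T_rep] at [true] and [false] reduces to the tuples defining [T1] and [T2]. *)
have T1P := Gproj_T phi true hX; have T2P := Gproj_T phi false hX.
by split; [exact: T1P | split=> [/T1P /T2P | /T2P /T1P]].
Qed.
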